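(* Let $(G_n,S_n)_{n\in\mathbb{N}}$ be a sequence of finite Cayley graphs with $\sup_n|S_n|<\infty$, and let $1\leqslant p<\infty$. The following conditions are equivalent: (1) The sequence $(G_n,S_n)_{n\in\mathbb{N}}$ does not coarsely embed into any $L^p$-space. (2) Up to taking a subsequence, there exist $r_n\to\infty$, a sequence of probability measures $\mu_n$ supported on $\Delta_{r_n}(G_n)$, and a constant $C<\infty$, such that for every $n$ and every map $f$ from $G_n$ to an $L^p$-space, $$\sum_{g,g'\in G_n}\|f(g)-f(g')\|^p\mu_n(g,g')\leqslant\frac{C}{|G_n|}\sum_{g\sim g'}\|f(g)-f(g')\|^p.$$ Moreover, $\mu_n$ is left-invariant: $\mu_n(gg_1,gg_2)=\mu_n(g_1,g_2)$ for all $g,g_1,g_2\in G_n$.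
   Context: $(G_n,S_n)$ is the Cayley graph of a finite group $G_n$ with respect to the generating set $S_n$, with edges joining $g$ and $gs$ ($s\in S_n$), equipped with its left-invariant word metric $d$; $g\sim g'$ means that $g,g'$ form an edge. For $r\geqslant0$, $\Delta_r(G_n)=\{(x,y)\in G_n\times G_n:\ d(x,y)\geqslant r\}$. An $L^p$-space is a Banach space $L^p(\Omega,\nu)$ for some measure space $(\Omega,\nu)$. Coarse embedding: a sequence of maps $\phi_n\colon X_n\to Y$ from metric spaces $(X_n,d_n)$ to a metric space $(Y,d_Y)$ is a coarse embedding of $(X_n)$ into $Y$ if there are two proper functions $\rho,\gamma\colon[0,\infty)\to[0,\infty)$ (independent of $n$) with $\rho(d_n(x,y))\leqslant d_Y(\phi_n(x),\phi_n(y))\leqslant\gamma(d_n(x,y))$ for all $n$ and all $x,y\in X_n$. *)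

(* Defs.v *)
From HB Require Import structures.
From mathcomp Require Import all_boot all_order all_algebra all_fingroup.
From mathcomp Require Import all_classical all_reals all_analysis.
Import Order.TTheory GRing.Theory Num.Theory.
Import numFieldNormedType.Exports.

Set Implicit Arguments.
Unset Strict Implicit.
Unset Printing Implicit Defensive.

Local Open Scope classical_set_scope.
Local Open Scope ring_scope.

Record cayley_graph := CayleyGraph {
  cg_group :> finGroupType;
  cg_gens : {set cg_group};
  cg_gensP : <<cg_gens>>%g = [set: cg_group]%SET }.

(* The generating set is not assumed symmetric: edges are unoriented, and words
   are written in the generators and their inverses. *)
Definition edge (G : cayley_graph) (g h : G) : bool :=
  [exists s in cg_gens G, (h == g * s)%g || (g == h * s)%g].

Definition is_word (G : cayley_graph) (w : seq G) : bool :=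
  all (fun s => (s \in cg_gens G) || (s^-1 \in cg_gens G)%g) w.

Definition has_word (G : cayley_graph) (x : G) (n : nat) : bool :=
  [exists w : n.-tuple G, is_word w && (x == \prod_(s <- w) s)%g].

Lemma has_word_exists (G : cayley_graph) (x : G) : exists n, has_word x n.
Proof.
have /gen_prodgP [n [c cS ->]] : x \in <<cg_gens G>>%g.
  by rewrite cg_gensP inE.
exists n; apply/existsP; exists (mktuple c); apply/andP; split.
  by apply/allP => s /mapP [i _ ->]; rewrite cS.
by rewrite big_map val_ord_tuple enumT [index_enum _]unlock.
Qed.

Definition word_length (G : cayley_graph) (x : G) : nat :=
  ex_minn (has_word_exists x).

Definition word_dist (G : cayley_graph) (x y : G) : nat :=
  word_length (x^-1 * y)%g.

Definition Delta (R : realType) (G : cayley_graph) (r : R) : {set G * G} :=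
  [set u | r <= (word_dist u.1 u.2)%:R]%SET.

Lemma le1_EFin (R : realType) (p : R) : 1 <= p -> (1 <= p%:E)%E.
Proof. by rewrite lee_fin. Qed.

Definition Lp_space (R : realType) (p : R) (p1 : 1 <= p) (d : measure_display)
    (T : measurableType d) (nu : {measure set T -> \bar R}) : Type :=
  LspaceType nu (le1_EFin p1).

(* [LspaceType] has no norm of its own, so the distance is computed on
   representatives; the integral does not depend on their choice. *)
Definition Lp_dist (R : realType) (p : R) (p1 : 1 <= p) (d : measure_display)
    (T : measurableType d) (nu : {measure set T -> \bar R})
    (f g : Lp_space p1 nu) : R :=
  fine ('N[nu]_p%:E [EFin \o ((f : T -> R) \- (g : T -> R))%R])%E.

(* A self-map of [0, +oo[, represented by a map on R whose values at negative
   reals are irrelevant, is proper when preimages of bounded sets are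
   bounded. *)
Definition proper_map (R : realType) (h : R -> R) : Prop :=
  (forall t, 0 <= t -> 0 <= h t) /\
  (forall B : set R, bounded_set B ->
     bounded_set ([set t | 0 <= t] `&` h @^-1` B)).

Definition coarse_embedding (R : realType) (X : nat -> Type)
    (dX : forall n, X n -> X n -> R) (Y : Type) (dY : Y -> Y -> R)
    (phi : forall n, X n -> Y) : Prop :=
  exists rho gamma : R -> R,
    [/\ proper_map rho, proper_map gamma &
        forall n (x y : X n),
          rho (dX n x y) <= dY (phi n x) (phi n y) <= gamma (dX n x y)].

Definition embeds_in_some_Lp (R : realType) (p : R) (p1 : 1 <= p)
    (G : nat -> cayley_graph) : Prop :=
  exists (d : measure_display) (T : measurableType d)
    (nu : {measure set T -> \bar R}) (phi : forall n, G n -> Lp_space p1 nu),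
    coarse_embedding (fun n (x y : G n) => (word_dist x y)%:R)
      (@Lp_dist R p p1 d T nu) phi.

Definition probability_on (R : realType) (G : cayley_graph)
    (A : {set G * G}) (mu : G -> G -> R) : Prop :=
  [/\ forall g g', 0 <= mu g g',
      \sum_(g : G) \sum_(g' : G) mu g g' = 1 &
      forall g g', (g, g') \notin A -> mu g g' = 0].

Definition left_invariant (R : realType) (G : cayley_graph)
    (mu : G -> G -> R) : Prop :=
  forall g g1 g2 : G, mu (g * g1)%g (g * g2)%g = mu g1 g2.

(* The right-hand sum runs over ordered pairs, so each edge between distinct
   vertices is counted twice; this only affects the constant. *)
Definition Lp_poincare (R : realType) (p : R) (p1 : 1 <= p) (G : cayley_graph)
    (mu : G -> G -> R) (C : R) : Prop :=
  forall (d : measure_display) (T : measurableType d)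
    (nu : {measure set T -> \bar R}) (f : G -> Lp_space p1 nu),
    \sum_(g : G) \sum_(g' : G) Lp_dist (f g) (f g') `^ p * mu g g' <=
    C / #|{: G}|%:R *
      \sum_(g : G) \sum_(g' : G | edge g g') Lp_dist (f g) (f g') `^ p.

Definition far_poincare_sequence (R : realType) (p : R) (p1 : 1 <= p)
    (G : nat -> cayley_graph) (r : nat -> R)
    (mu : forall n, G n -> G n -> R) (C : R) : Prop :=
  [/\ forall n, 0 <= r n,
      r @ \oo --> +oo,
      forall n, probability_on (Delta (G n) (r n)) (mu n) &
      forall n, Lp_poincare p1 (mu n) C].

(* Main.v *)
Require Import Defs.
From HB Require Import structures.
From mathcomp Require Import all_boot all_order all_algebra all_fingroup.
From mathcomp Require Import all_classical all_reals all_analysis.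
From mathcomp Require Import measurable_realfun ring lra.
Import Order.TTheory GRing.Theory Num.Theory.
Import numFieldNormedType.Exports.

Set Implicit Arguments.
Unset Strict Implicit.
Unset Printing Implicit Defensive.

Local Open Scope classical_set_scope.
Local Open Scope ring_scope.

(** Poincare inequalities at large scale obstruct coarse embeddings because
    the right-hand side only sees pairs at distance at most one.  If [phi]
    embeds the graphs coarsely, then applying the inequality to [phi] bounds
    the right-hand side by a constant (the degrees are bounded), while the
    left-hand side is an average of [rho (d (g, g')) ^ p] over pairs at
    distance at least [r n], which tends to infinity
    ([poincare_not_embeds]).

    The converse is a duality argument on each group [G].  A finite family [F]
    of functions [a : G -> R] defines the left-invariant kernel
    [displacement F x = sum_a sum_g |a g - a (g x)|^p].  These kernels form a
    convex cone, since families can be concatenated and rescaled, and each of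
    them is the [p]-th power of the distance of some map from [G] to l^p
    ([displacement_realization]).  Compare a kernel with its total
    [gradient F] over the generators and their inverses.  By separating the
    convex cone of the functions [displacement F - C * gradient F] from the
    vectors that are positive on the elements of length at least [r], one of
    the following holds ([displacement_dichotomy]):
    - some family of gradient at most one displaces all the elements of length
      at least [r] by at least [C];
    - some probability [m] on these elements satisfies
      [sum_x m x * displacement F x <= C * gradient F] for every [F].

    If for every [C] there is an [r] such that the first alternative holds for
    all the graphs, adding up such families for growing [C], with summable
    weights, gives maps to l^p of the natural numbers that are a coarse
    embedding ([embeds_of_displacement]).  Otherwise some [C] and, for every
    [r], some graph give the second alternative.  Spreading [m] over the pairs
    [(g, g x)] gives a left-invariant probability for which the Poincare
    inequality holds for real functions.  It extends to functions with values
    in any L^p-space because the [p]-th power of an L^p-distance is the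
    integral of [p]-th powers of distances between real numbers
    ([Lp_dist_transfer]).  Such graphs cannot stay among finitely many, as
    their diameters are at least [r], so they form a subsequence. *)

(** * Separation of convex cones in finite dimension *)

(** Only the inequality is asked of scalings; the converse one follows, see
    [sublinearZ_ge]. *)
Definition sublinear (R : realType) (T : Type) (theta : (T -> R) -> R) : Prop :=
  (forall u v, theta (u \+ v) <= theta u + theta v) /\
  (forall a u, 0 <= a -> theta (a \*o u) <= a * theta u).

Lemma sublinear_ge0 (R : realType) (T : Type) (theta : (T -> R) -> R) :
  sublinear theta -> 0 <= theta (fun=> 0).
Proof.
move=> [D _]; have := D (fun=> 0) (fun=> 0).
by rewrite (_ : _ \+ _ = fun=> 0) ?lerDl//; apply/funext => x /=; rewrite addr0.
Qed.

Lemma sublinearZ_ge (R : realType) (T : Type) (theta : (T -> R) -> R) a u :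
  sublinear theta -> 0 <= a -> a * theta u <= theta (a \*o u).
Proof.
move=> theta_sl; rewrite le_eqVlt => /predU1P[<-|a_gt0].
  rewrite mul0r (_ : _ \*o _ = fun=> 0) ?sublinear_ge0//.
  by apply/funext => x /=; rewrite mul0r.
have [_ Z] := theta_sl.
have /Z : 0 <= a^-1 by rewrite invr_ge0 ltW.
move=> /(_ (a \*o u)).
rewrite (_ : a^-1 \*o _ = u); last first.
  by apply/funext => x /=; rewrite mulKf// gt_eqF.
by rewrite ler_pdivlMl.
Qed.

(** The standard one-vector decrease in the proof of the Hahn-Banach theorem:
    the result is still sublinear, lies below [theta], and is linear on the
    line spanned by [e].  Repeating it along a basis makes the functional
    linear. *)
Definition flatten_along (R : realType) (T : Type) (theta : (T -> R) -> R)
    (e u : T -> R) : R :=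
  inf [set theta (u \+ (t \*o e)) - t * theta e | t in [set t : R | 0 <= t]].

Section flattening.
Context (R : realType) (T : Type) (theta : (T -> R) -> R) (e : T -> R).
Hypothesis theta_sl : sublinear theta.

Let flatten_lb u t : 0 <= t ->
  - theta (fun x => - u x) <= theta (u \+ (t \*o e)) - t * theta e.
Proof.
move=> t0; have [D _] := theta_sl.
have := D (u \+ (t \*o e)) (fun x => - u x).
rewrite (_ : _ \+ (fun x => - u x) = t \*o e); last first.
  by apply/funext => x /=; rewrite addrC addrA addNr add0r.
have := sublinearZ_ge e theta_sl t0; lra.
Qed.

Let flatten_has_inf u : has_inf
  [set theta (u \+ (t \*o e)) - t * theta e | t in [set t : R | 0 <= t]].
Proof.
split; first by exists (theta (u \+ (0 \*o e)) - 0 * theta e), 0 => /=.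
by exists (- theta (fun x => - u x)) => _ [t t0 <-]; exact: flatten_lb.
Qed.

Lemma flatten_along_le_at u t : 0 <= t ->
  flatten_along theta e u <= theta (u \+ (t \*o e)) - t * theta e.
Proof. by move=> t0; apply: ge_inf; [case: (flatten_has_inf u)|exists t]. Qed.

Lemma flatten_along_le u : flatten_along theta e u <= theta u.
Proof.
apply: (le_trans (flatten_along_le_at u (lexx 0))).
rewrite mul0r subr0 (_ : _ \+ _ = u)//.
by apply/funext => x /=; rewrite mul0r addr0.
Qed.

Lemma flatten_along_flat :
  flatten_along theta e e + flatten_along theta e (fun x => - e x) <= 0.
Proof.
have := flatten_along_le e.
have := flatten_along_le_at (fun x => - e x) ler01.
have [_ Z] := theta_sl; have := Z 0 (fun=> 0) (lexx 0).
rewrite mul0r (_ : 0 \*o _ = fun=> 0); last first.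
  by apply/funext => x /=; rewrite mul0r.
rewrite (_ : _ \+ _ = fun=> 0); last first.
  by apply/funext => x /=; rewrite mul1r addNr.
lra.
Qed.

Lemma flatten_along_sublinear : sublinear (flatten_along theta e).
Proof.
have [D Z] := theta_sl; split=> [u v|a u a0].
  rewrite -lerBlDr; apply: lb_le_inf; first by case: (flatten_has_inf u).
  move=> _ [s s0 <-]; rewrite lerBlDr addrC -lerBlDr.
  apply: lb_le_inf; first by case: (flatten_has_inf v).
  move=> _ [t t0 <-]; rewrite lerBlDr.
  have /= := flatten_along_le_at (u \+ v) (addr_ge0 s0 t0).
  have := D (u \+ (s \*o e)) (v \+ (t \*o e)).
  rewrite (_ : (u \+ _) \+ (v \+ _) = (u \+ v) \+ ((s + t) \*o e)); last first.
    by apply/funext => x /=; ring.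
  lra.
move: a0; rewrite le_eqVlt => /predU1P[<-|a0].
  rewrite mul0r; apply: (le_trans (flatten_along_le _)).
  by have := Z 0 u (lexx 0); rewrite mul0r.
rewrite -ler_pdivrMl//; apply: lb_le_inf; first by case: (flatten_has_inf u).
move=> _ [t t0 <-]; rewrite ler_pdivrMl//.
apply: (le_trans (flatten_along_le_at _ (mulr_ge0 (ltW a0) t0))).
rewrite mulrBr mulrA lerD2r.
rewrite (_ : _ \+ _ = a \*o (u \+ (t \*o e))); last first.
  by apply/funext => x /=; ring.
exact/Z/ltW.
Qed.

End flattening.

(** A sublinear functional has [0 <= theta e + theta (- e)], so the bound
    asked of [theta'] says that it is linear on the line of each [e].  It survives
    the later steps because they only decrease the functional. *)
Lemma exists_flat_sublinear (R : realType) (T : Type) (es : seq (T -> R))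
    (theta : (T -> R) -> R) : sublinear theta ->
  exists theta', [/\ sublinear theta', forall u, theta' u <= theta u &
    forall i, (i < size es)%N -> let e := nth (fun=> 0) es i in
      theta' e + theta' (fun x => - e x) <= 0].
Proof.
elim: es theta => [|e es IH] theta theta_sl; first by exists theta.
have [theta' [sl' le' flat']] := IH _ (flatten_along_sublinear e theta_sl).
exists theta'; split=> //.
  by move=> u; exact/(le_trans (le' u))/flatten_along_le.
move=> [_|i]; last exact: flat'.
by apply: le_trans (flatten_along_flat e theta_sl); apply: lerD.
Qed.

Lemma sublinear_sum (R : realType) (T : Type) (theta : (T -> R) -> R)
    (I : eqType) (s : seq I) (F : I -> T -> R) : sublinear theta -> s != [::] ->
  theta (fun x => \sum_(i <- s) F i x) <= \sum_(i <- s) theta (F i).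
Proof.
move=> [D _]; elim: s => // i s; have [->|s0] := eqVneq s [::].
  by move=> _ _; under eq_fun do rewrite big_seq1; rewrite big_seq1.
move=> /(_ isT) IH _; rewrite big_cons.
under eq_fun do rewrite big_cons.
by apply: (le_trans (D _ _)); rewrite lerD2l.
Qed.

(** Once [theta'] is linear on each coordinate line, subadditivity gives
    [theta' (- v) <= - sum_x theta' (dl x) * v x], where [dl x] is the
    indicator of [x], and [0 <= theta' v + theta' (- v)] turns this into the
    wanted lower bound on [theta' v]. *)
Lemma hahn_banach_fin (R : realType) (T : finType) (theta : (T -> R) -> R) :
  sublinear theta ->
  exists m : T -> R, forall v, \sum_x m x * v x <= theta v.
Proof.
pose dl (y x : T) : R := (x == y)%:R.
move=> /(exists_flat_sublinear (map dl (enum T)))[theta' [sl' le' flat']].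
have flat y : theta' (dl y) + theta' (fun x => - dl y x) <= 0.
  have := flat' (index y (enum T)); rewrite size_map index_mem mem_enum.
  by move=> /(_ isT); rewrite (nth_map y) ?index_mem ?mem_enum// nth_index ?mem_enum.
exists (fun y => theta' (dl y)) => v; apply: le_trans (le' v).
have [D Z] := sl'.
have le_neg : theta' (fun x => - v x) <= \sum_y theta' ((- v y) \*o dl y).
  have [T0|T0] := eqVneq (enum T) [::].
    rewrite -big_enum /= T0 big_nil (_ : (fun x => _) = (0 \*o (fun x => - v x))).
      by rewrite -[leRHS](mul0r (theta' (fun x => - v x))); exact: Z.
    by apply/funext => x; have := mem_enum T x; rewrite T0.
  rewrite -big_enum; apply: le_trans (sublinear_sum _ _ _) => //.
  rewrite le_eqVlt; apply/orP; left; apply/eqP; congr theta'.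
  apply/funext => x; rewrite big_enum (bigD1 x)//= /dl eqxx mulr1.
  by rewrite big1 ?addr0// => y /negPf yx; rewrite eq_sym yx mulr0.
have coord y : theta' ((- v y) \*o dl y) <= - (theta' (dl y) * v y).
  have [v0|v0] := leP 0 (v y).
    rewrite (_ : _ \*o _ = v y \*o (fun x => - dl y x)); last first.
      by apply/funext => x /=; ring.
    apply: (le_trans (Z _ _ v0)); rewrite mulrC -mulNr ler_wpM2r//.
    by have := flat y; lra.
  have /Z : 0 <= - v y by rewrite oppr_ge0 ltW.
  by move=> /(_ (dl y)); rewrite mulNr mulrC.
have := D v (fun x => - v x).
rewrite (_ : _ \+ _ = fun=> 0); last by apply/funext => x /=; rewrite addrN.
have := sublinear_ge0 sl'.
have : \sum_y theta' ((- v y) \*o dl y) <= \sum_y - (theta' (dl y) * v y).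
  by apply: ler_sum => y _.
rewrite sumrN; lra.
Qed.

(** The measure is a linear functional below
    [theta v = inf {c | v <= q + c on B for some q in Q}], which is bounded
    below since no element of [Q] is positive on [B].  Testing [m <= theta] on
    the constants [1] and [-1] gives the total mass, on the opposites of
    indicators the nonnegativity, on indicators of points outside [B] the
    support, and on [Q] itself the separation. *)
Lemma cone_separation (R : realType) (T : finType) (B : {set T})
    (Q : (T -> R) -> Prop) :
  Q (fun=> 0) ->
  (forall u v, Q u -> Q v -> Q (u \+ v)) ->
  (forall (a : R) u, 0 <= a -> Q u -> Q (a \*o u)) ->
  (forall q, Q q -> exists2 x, x \in B & q x <= 0) ->
  exists m : T -> R, [/\ forall x, 0 <= m x, \sum_x m x = 1,
    forall x, x \notin B -> m x = 0 &
    forall q, Q q -> \sum_x m x * q x <= 0].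
Proof.
move=> Q0 QD QZ Qneg.
pose A (v : T -> R) := [set c : R | exists2 q, Q q & forall x, x \in B -> v x <= q x + c].
pose theta (v : T -> R) := inf (A v).
have v_le (v : T -> R) x : `|v x| <= \sum_y `|v y|.
  by rewrite [leRHS](bigD1 x)//= lerDl; apply: sumr_ge0.
have Alb v : lbound (A v) (- \sum_y `|v y|).
  move=> c [q /Qneg[x xB qx] /(_ x xB) vq].
  by have := v_le v x; have := ler_norm (- v x); rewrite normrN; lra.
have Ainf v : has_inf (A v).
  split; last by exists (- \sum_y `|v y|); exact: Alb.
  exists (\sum_y `|v y|), (fun=> 0) => // x _; rewrite add0r.
  exact/(le_trans (ler_norm _))/v_le.
have theta_le v c q : Q q -> (forall x, x \in B -> v x <= q x + c) -> theta v <= c.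
  by move=> Qq vq; apply: ge_inf; [case: (Ainf v)|exists q].
have theta_sl : sublinear theta.
  split=> [u v|a u a0].
    rewrite -lerBlDr; apply: lb_le_inf; first by case: (Ainf u).
    move=> c [q Qq uq]; rewrite lerBlDr addrC -lerBlDr.
    apply: lb_le_inf; first by case: (Ainf v).
    move=> d [q' Qq' vq]; rewrite lerBlDr.
    apply: (theta_le _ _ (q \+ q')); first exact: QD.
    by move=> x xB /=; have := uq x xB; have := vq x xB; lra.
  move: a0; rewrite le_eqVlt => /predU1P[<-|a0].
    by rewrite mul0r; apply: (theta_le _ _ (fun=> 0)) => // x _ /=; rewrite mul0r add0r.
  rewrite -ler_pdivrMl//; apply: lb_le_inf; first by case: (Ainf u).
  move=> c [q Qq uq]; rewrite ler_pdivrMl//.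
  apply: (theta_le _ _ (a \*o q)); first exact/QZ/Qq/ltW.
  by move=> x xB /=; rewrite -mulrDr ler_pM2l// uq.
have [m m_le] := hahn_banach_fin theta_sl.
pose dl (y x : T) : R := (x == y)%:R.
have m_dl a y : \sum_x m x * (a * dl y x) = a * m y.
  rewrite (bigD1 y)//= /dl eqxx mulr1 big1 ?addr0; first by rewrite mulrC.
  by move=> x /negPf ->; rewrite !mulr0.
have m_ge0 x : 0 <= m x.
  have : -1 * m x <= 0; last by lra.
  rewrite -m_dl; apply: (le_trans (m_le _)).
  apply: (theta_le _ _ (fun=> 0)) => // y _ /=; rewrite addr0.
  by rewrite mulN1r oppr_le0 /dl ler0n.
exists m; split=> //.
- apply/eqP; rewrite eq_le; apply/andP; split.
    have := m_le (fun=> 1); under eq_bigr do rewrite mulr1.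
    by move=> /le_trans; apply; apply: (theta_le _ _ (fun=> 0)) => // x _; rewrite add0r.
  have := m_le (fun=> -1); under eq_bigr do rewrite mulrN1.
  rewrite sumrN => /(@le_trans _ _ _) h.
  have /h : theta (fun=> -1) <= -1.
    by apply: (theta_le _ _ (fun=> 0)) => // x _; rewrite add0r.
  lra.
- move=> x xB; apply/eqP; rewrite eq_le m_ge0 andbT -[m x]mul1r -m_dl.
  apply: (le_trans (m_le _)).
  apply: (theta_le _ _ (fun=> 0)) => // y yB; rewrite addr0 /dl mul1r.
  by case: eqP => // yx; move: xB; rewrite -yx yB.
- move=> q Qq; apply: (le_trans (m_le _)).
  by apply: (theta_le _ _ q) => // x _; rewrite addr0.
Qed.

(** * Finite configurations in L^p-spaces *)

Lemma measurable_Lp (R : realType) (p : R) (p1 : 1 <= p) (d : measure_display)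
    (T : measurableType d) (nu : {measure set T -> \bar R})
    (f : Lp_space p1 nu) : measurable_fun setT (f : T -> R).
Proof.
(* Elements of Lspace take values in [measurableTypeR R], whose measurable sets
   are those of [R] only up to conversion. *)
have mf := measurable_funPT
  (generic_quotient.repr (f : {mfun_ nu, T >-> measurableTypeR R})).
by move=> mT Y mY; exact: mf.
Qed.

Lemma powR_Lp_dist (R : realType) (p : R) (p1 : 1 <= p) (d : measure_display)
    (T : measurableType d) (nu : {measure set T -> \bar R})
    (f g : Lp_space p1 nu) :
  ((Lp_dist f g) `^ p)%:E = (\int[nu]_t (`|(f : T -> R) t - (g : T -> R) t| `^ p)%:E)%E.
Proof.
have p_gt0 : 0 < p by rewrite (lt_le_trans _ p1).
have p_neq0 : p != 0 by rewrite gt_eqF.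
have fin (h : Lp_space p1 nu) : (h : T -> R) \in Lfun nu p%:E.
  by apply/andP; split; rewrite inE/=; [exact: measurable_Lp|exact: Lebesgue_finite].
have fg : ((f : T -> R) \- g)%R \in Lfun nu p%:E.
  rewrite -[X in X \in _]/((f : T -> R) + - (g : T -> R)).
  have [_ D] := Lfun_addr_closed nu (le1_EFin p1).
  apply: D; first exact: fin.
  by apply: Lfun_oppr_closed; exact: fin.
rewrite /Lp_dist -poweR_EFin fineK.
  by rewrite poweR_Lnorm//; under eq_integral do rewrite /= poweR_EFin.
rewrite ge0_fin_numE ?Lnorm_ge0//.
by move: fg; rewrite inE => /andP[_]; rewrite inE.
Qed.

Lemma measurable_powR_diff (R : realType) (p : R) (d : measure_display)
    (T : measurableType d) (f g : T -> R) :
  measurable_fun setT f -> measurable_fun setT g ->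
  measurable_fun setT (fun t => `|f t - g t| `^ p).
Proof.
move=> mf mg.
apply: (@measurableT_comp _ _ _ _ _ _ (@powR R ^~ p)) => //.
by apply: measurableT_comp => //; exact: measurable_funB.
Qed.

(** An inequality between weighted sums of [p]-th powers of distances passes
    from the real line to L^p-spaces: apply it at each point and integrate. *)
Lemma Lp_dist_transfer (R : realType) (p : R) (p1 : 1 <= p) (I : finType)
    (w w' : I -> I -> R) :
  (forall i j, 0 <= w i j) -> (forall i j, 0 <= w' i j) ->
  (forall a : I -> R,
     \sum_i \sum_j w i j * `|a i - a j| `^ p <=
     \sum_i \sum_j w' i j * `|a i - a j| `^ p) ->
  forall (d : measure_display) (T : measurableType d)
    (nu : {measure set T -> \bar R}) (f : I -> Lp_space p1 nu),
  \sum_i \sum_j w i j * Lp_dist (f i) (f j) `^ p <=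
  \sum_i \sum_j w' i j * Lp_dist (f i) (f j) `^ p.
Proof.
move=> w0 w'0 ineq d T nu f.
pose D i j (t : T) : \bar R := (`|(f i : T -> R) t - (f j : T -> R) t| `^ p)%:E.
have mD i j : measurable_fun setT (D i j).
  by apply/measurable_EFinP/measurable_powR_diff; exact: measurable_Lp.
have mwD (c : R) i j : measurable_fun setT (fun t => c%:E * D i j t)%E.
  exact: measurable_funeM.
have wD0 (c : R) i j t : 0 <= c -> (0 <= c%:E * D i j t)%E.
  by move=> c0; rewrite mule_ge0 ?lee_fin ?powR_ge0.
have E (c : I -> I -> R) : (forall i j, 0 <= c i j) ->
    (\sum_i \sum_j c i j * Lp_dist (f i) (f j) `^ p)%:E =
    (\int[nu]_t \sum_i \sum_j (c i j)%:E * D i j t)%E.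
  move=> c0; rewrite ge0_integral_sum//; last first.
  - by move=> i t _; apply: sume_ge0 => j _; exact: wD0.
  - by move=> i; exact: emeasurable_sum.
  rewrite -sumEFin; apply: eq_bigr => i _.
  rewrite ge0_integral_sum//; last by move=> j t _; exact: wD0.
  rewrite -sumEFin; apply: eq_bigr => j _.
  rewrite EFinM powR_Lp_dist ge0_integralZl//; last by rewrite lee_fin.
  by move=> t _; rewrite lee_fin powR_ge0.
rewrite -lee_fin !E//; apply: ge0_le_integral => //.
- by move=> t _; apply: sume_ge0 => i _; apply: sume_ge0 => j _; exact: wD0.
- by apply: emeasurable_sum => i; exact: emeasurable_sum.
- by apply: emeasurable_sum => i; exact: emeasurable_sum.
move=> t _.
have EE (c : I -> I -> R) : (\sum_i \sum_j (c i j)%:E * D i j t)%E =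
    (\sum_i \sum_j c i j * `|(f i : T -> R) t - (f j : T -> R) t| `^ p)%:E.
  by rewrite -sumEFin; apply: eq_bigr => i _; rewrite -sumEFin.
by rewrite !EE lee_fin; exact: (ineq (fun i => (f i : T -> R) t)).
Qed.

Lemma exists_Lspace (R : realType) (p : R) (p1 : 1 <= p) (d : measure_display)
    (T : measurableType d) (nu : {measure set T -> \bar R}) (h : T -> R) :
  measurable_fun setT h -> (\int[nu]_t (`|h t| `^ p)%:E < +oo)%E ->
  exists F : Lp_space p1 nu, (F : T -> R) = h %[ae nu].
Proof.
move=> mh fin_h.
have p_gt0 : 0 < p by rewrite (lt_le_trans _ p1).
have mh' : @measurable_fun _ _ T (measurableTypeR R) setT h.
  by move=> mT Y mY; exact: mh.
pose hM : {mfun T >-> measurableTypeR R} :=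
  HB.pack h (@isMeasurableFun.Build _ _ T (measurableTypeR R) h mh').
pose F : {mfun_ nu, T >-> measurableTypeR R} := (\pi_({mfun_ nu, T >-> measurableTypeR R}) hM)%qT.
have Fh : (F : T -> R) = h %[ae nu].
  have : (generic_quotient.repr F == hM %[mod {mfun_ nu, T >-> measurableTypeR R}])%qT by rewrite reprK.
  by rewrite eqmodE => /asboolP.
have finF : finite_norm nu p%:E F.
  rewrite /finite_norm unlock; under eq_integral do rewrite /=.
  have -> : (\int[nu]_x (`|F x| `^ p)%:E = \int[nu]_t (`|h t| `^ p)%:E)%E.
    apply: ae_eq_integral => //.
    - apply/measurable_EFinP.
      apply: (@measurableT_comp _ _ _ _ _ _ (@powR R ^~ p)) => //.
      exact: measurableT_comp.
    - apply/measurable_EFinP.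
      apply: (@measurableT_comp _ _ _ _ _ _ (@powR R ^~ p)) => //.
      exact: measurableT_comp.
    by apply: filterS Fh => t /(_ I) Ft _; rewrite Ft.
  exact: poweR_lty.
pose L : Lp_space p1 nu := HB.pack F (isFinLebesgue.Build d T R nu p%:E (le1_EFin p1) F finF).
by exists L.
Qed.

(** Choosing representatives is harmless: the values [phi i] are classes of
    functions up to null sets, and the integral of the difference does not see
    the choice. *)
Lemma finite_vector_in_lp (R : realType) (p : R) (p1 : 1 <= p) (I : finType) (n : nat)
    (v : I -> nat -> R) :
  exists phi : I -> Lp_space p1 (@counting nat R), forall i j,
    Lp_dist (phi i) (phi j) `^ p = \sum_(0 <= k < n) `|v i k - v j k| `^ p.
Proof.
have p_neq0 : p != 0 by rewrite gt_eqF// (lt_le_trans _ p1).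
(* Truncation to the first [n] coordinates makes the vectors summable. *)
pose h i k := if (k < n)%N then v i k else 0.
have int_fin (u : nat -> R) : (forall k, (n <= k)%N -> u k = 0) ->
    (\int[counting]_k (`|u k| `^ p)%:E = (\sum_(0 <= k < n) `|u k| `^ p)%:E)%E.
  move=> u0; rewrite ge0_integral_count => [|k]; last by rewrite lee_fin powR_ge0.
  rewrite (nneseries_split 0 n) => [|k _]; last by rewrite lee_fin powR_ge0.
  rewrite add0n eseries0 ?adde0 ?sumEFin// => k nk _.
  by rewrite u0// normr0 powR0.
have /choice[phi phiE] i : exists F : Lp_space p1 (@counting nat R),
    (F : nat -> R) = h i %[ae (@counting nat R)].
  apply: exists_Lspace => //.
  by rewrite int_fin ?ltry// => k nk; rewrite /h ltnNge nk.
exists phi => i j; apply/EFin_inj; rewrite powR_Lp_dist.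
transitivity (\int[counting]_k (`|h i k - h j k| `^ p)%:E)%E.
  apply: ae_eq_integral => //.
  apply: filterS2 (phiE i) (phiE j) => k /(_ Logic.I) Ei /(_ Logic.I) Ej _.
  by rewrite Ei Ej.
rewrite (int_fin (fun k => h i k - h j k)) => [|k nk]; last first.
  by rewrite /h ltnNge nk/= subrr.
congr EFin; rewrite big_nat [RHS]big_nat; apply: eq_bigr => k /andP[_ kn].
by rewrite /h kn.
Qed.

(** * Left-invariant kernels of type l^p on a finite group *)

(** The constant is not sharp, but any constant depending on [p] alone serves
    to bound a kernel along words. *)
Lemma powR_addr_le (R : realType) (p u v : R) : 0 <= p -> 0 <= u -> 0 <= v ->
  (u + v) `^ p <= 2 `^ p * (u `^ p + v `^ p).
Proof.
move=> p0 u0 v0.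
wlog uv : u v u0 v0 / u <= v.
  move=> H; have [/ltW|] := ltP v u; last exact: H.
  by move=> /(H _ _ v0 u0); rewrite addrC [X in _ * X]addrC.
apply: (@le_trans _ _ ((2 * v) `^ p)).
  by rewrite ge0_ler_powR ?nnegrE//; lra.
rewrite powRM// ler_wpM2l ?powR_ge0// lerDr powR_ge0//.
Qed.

Section displacement.
Context (R : realType) (p : R) (gT : finGroupType).
Implicit Types (F : seq (gT -> R)) (x y : gT).

(** For [F] seen as one map [f] from the group to a finite-dimensional l^p, this
    is [sum_g |f g - f (g x)|_p ^ p], the [p]-th power of how far right
    translation by [x] moves [f]. *)
Definition displacement F x : R :=
  \sum_(a <- F) \sum_g `|a g - a (g * x)%g| `^ p.

Lemma displacement_ge0 F x : 0 <= displacement F x.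
Proof. by apply: sumr_ge0 => a _; apply: sumr_ge0 => g _; exact: powR_ge0. Qed.

Lemma displacement_nil x : displacement [::] x = 0.
Proof. exact: big_nil. Qed.

Lemma displacement_cat F F' x :
  displacement (F ++ F') x = displacement F x + displacement F' x.
Proof. exact: big_cat. Qed.

Lemma displacement_flatten (I : Type) (s : seq I) (F : I -> seq (gT -> R)) x :
  displacement (flatten [seq F i | i <- s]) x = \sum_(i <- s) displacement (F i) x.
Proof.
elim: s => [|i s IH] /=; first by rewrite displacement_nil big_nil.
by rewrite displacement_cat IH big_cons.
Qed.

(** Kernels are homogeneous of degree [p] in the family, so scaling by [c]
    requires multiplying the functions by [c ^ (1/p)]. *)
Lemma displacement_scale (p_gt0 : 0 < p) F (c : R) : 0 <= c ->
  exists F', forall x, displacement F' x = c * displacement F x.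
Proof.
move=> c0; exists [seq c `^ p^-1 \*o a | a <- F] => x.
rewrite /displacement big_map mulr_sumr; apply: eq_bigr => a _.
rewrite mulr_sumr; apply: eq_bigr => g _ /=.
rewrite -mulrBr normrM (ger0_norm (powR_ge0 _ _)) powRM ?powR_ge0//.
by rewrite -powRrM mulVf ?gt_eqF// powRr1.
Qed.

Lemma displacement1 (p_gt0 : 0 < p) F : displacement F 1%g = 0.
Proof.
apply: big1 => a _; apply: big1 => g _.
by rewrite mulg1 subrr normr0 powR0// gt_eqF.
Qed.

Lemma displacementM (p_gt0 : 0 < p) F x y :
  displacement F (x * y)%g <= 2 `^ p * (displacement F x + displacement F y).
Proof.
rewrite /displacement -big_split mulr_sumr /=; apply: ler_sum => a _.
rewrite [X in _ <= _ * (_ + X)](reindex_inj (mulIg x)) /=.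
rewrite -big_split mulr_sumr /=; apply: ler_sum => g _.
apply: le_trans (powR_addr_le (ltW p_gt0) (normr_ge0 _) (normr_ge0 _)).
by rewrite ge0_ler_powR ?nnegrE ?(ltW p_gt0)// mulgA ler_distD.
Qed.

End displacement.

(** * Words and edges in a Cayley graph *)

Section word_length.
Context (G : cayley_graph).
Implicit Types (x y s : G) (w : seq G).

Lemma word_length_ex x :
  exists w, [/\ is_word w, x = (\prod_(s <- w) s)%g & size w = word_length x].
Proof.
rewrite /word_length; case: ex_minnP => n /existsP[w /andP[wW /eqP xw]] _.
by exists w; rewrite size_tuple.
Qed.

Lemma word_length_le w : is_word w -> (word_length (\prod_(s <- w) s)%g <= size w)%N.
Proof.
move=> wW; rewrite /word_length; case: ex_minnP => n _; apply.
by apply/existsP; exists (in_tuple w); rewrite wW eqxx.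
Qed.

Lemma edgeE (g h : G) : edge g h = edge 1%g (g^-1 * h)%g.
Proof.
apply: eq_existsb => s; congr (_ && (_ || _)).
  by rewrite mul1g; apply/eqP/eqP => [->|<-]; rewrite ?mulKg ?mulKVg.
by rewrite -mulgA [RHS]eq_sym [LHS]eq_mulVg1.
Qed.

Lemma edge1E s : edge 1%g s = (s \in cg_gens G) || (s^-1 \in cg_gens G)%g.
Proof.
apply/existsP/orP => [[t /andP[tS /orP[]/eqP]]|[] sS].
- by rewrite mul1g => ->; left.
- by move=> /esym/eqP; rewrite -eq_invg_mul => /eqP st; right; rewrite st.
- by exists s; rewrite sS mul1g eqxx.
- by exists s^-1%g; rewrite sS mulgV eqxx orbT.
Qed.

Lemma word_dist_edge (g h : G) : edge g h -> (word_dist g h <= 1)%N.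
Proof.
rewrite edgeE edge1E /word_dist => e.
by have := @word_length_le [:: g^-1 * h]%g; rewrite big_seq1; apply; rewrite /= e.
Qed.

Lemma card_edge_le (D : nat) (g : G) : (#|cg_gens G| <= D)%N ->
  (#|[pred h | edge g h]| <= D + D)%N.
Proof.
move=> SD.
have sub : [pred h | edge g h] \subset
    ([set (g * s)%g | s in cg_gens G] :|: [set (g * s^-1)%g | s in cg_gens G])%SET.
  apply/fintype.subsetP => h; rewrite !inE edgeE edge1E => /orP[] sS; apply/orP.
    by left; apply/imsetP; exists (g^-1 * h)%g => //; rewrite mulKVg.
  by right; apply/imsetP; exists (g^-1 * h)^-1%g => //; rewrite invgK mulKVg.
apply: (leq_trans (subset_leq_card sub)); apply: (leq_trans (leq_card_setU _ _)).
by apply: leq_add; exact: (leq_trans (leq_imset_card _ _)).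
Qed.

End word_length.

(** * Displacement against gradient *)

(** Since the edges are the pairs [(g, g s)] with [s] or its inverse a
    generator, this is the [p]-th power energy of [F] summed over the ordered
    edges of the graph. *)
Definition gradient (R : realType) (p : R) (G : cayley_graph) (F : seq (G -> R)) : R :=
  \sum_(s | edge 1%g s) displacement p F s.

(** Each letter of a word multiplies the bound by the constant of the
    approximate triangle inequality [displacementM].  In particular a family
    without gradient has no displacement. *)
Lemma displacement_le_gradient (R : realType) (p : R) (G : cayley_graph)
    (F : seq (G -> R)) (x : G) : 0 < p ->
  displacement p F x <= (2 `^ p * 2) ^+ word_length x * gradient p F.
Proof.
move=> p_gt0; have [w [wW -> <-]] := word_length_ex x.
have grad_ge0 : 0 <= gradient p F by apply: sumr_ge0 => s _; exact: displacement_ge0.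
have A1 : 1 <= 2 `^ p * 2 :> R.
  have : 2 `^ 0 <= 2 `^ p :> R by apply: ler_powR; [lra|exact: ltW].
  by rewrite powRr0; lra.
elim: w wW => [|s w IH] /=.
  by move=> _; rewrite big_nil displacement1// mulr_ge0 ?exprn_ge0//; lra.
move=> /andP[sS /IH{}IH]; rewrite big_cons.
apply: (le_trans (displacementM p_gt0 _ _ _)).
rewrite exprS -!mulrA ler_wpM2l ?powR_ge0// mulrA mulr2n !mulrDl !mul1r lerD//.
apply: (@le_trans _ _ (gradient p F)).
  rewrite /gradient (bigD1 s) ?edge1E//= lerDl.
  by apply: sumr_ge0 => t _; exact: displacement_ge0.
by rewrite ler_peMl// exprn_ege1.
Qed.

Section gradient.
Context (R : realType) (p : R) (G : cayley_graph).
Implicit Types F : seq (G -> R).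

Lemma gradient_ge0 F : 0 <= gradient p F.
Proof. by apply: sumr_ge0 => s _; exact: displacement_ge0. Qed.

Lemma gradient_nil : gradient p ([::] : seq (G -> R)) = 0.
Proof. by apply: big1 => s _; exact: displacement_nil. Qed.

Lemma gradient_cat F F' : gradient p (F ++ F') = gradient p F + gradient p F'.
Proof. by rewrite -big_split; apply: eq_bigr => s _; exact: displacement_cat. Qed.

Lemma gradient_flatten (I : Type) (s : seq I) (F : I -> seq (G -> R)) :
  gradient p (flatten [seq F i | i <- s]) = \sum_(i <- s) gradient p (F i).
Proof.
by elim: s => [|i s IH] /=; rewrite ?big_nil ?gradient_nil// gradient_cat IH big_cons.
Qed.

Lemma gradient_scale F F' (c : R) :
  (forall x, displacement p F' x = c * displacement p F x) ->
  gradient p F' = c * gradient p F.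
Proof. by move=> FF'; rewrite [RHS]mulr_sumr; apply: eq_bigr. Qed.

End gradient.

(** A kernel exceeding [C] times its gradient on all long elements gives the
    first alternative once it is rescaled to gradient one; if there is no such
    kernel, [cone_separation] gives the second. *)
Lemma displacement_dichotomy (R : realType) (p : R) (G : cayley_graph)
    (C : R) (r : nat) : 0 < p ->
  (exists F : seq (G -> R), gradient p F <= 1 /\
     forall x, (r <= word_length x)%N -> C <= displacement p F x) \/
  (exists m : G -> R, [/\ forall x, 0 <= m x, \sum_x m x = 1,
     forall x, (word_length x < r)%N -> m x = 0 &
     forall F, \sum_x m x * displacement p F x <= C * gradient p F]).
Proof.
move=> p_gt0.
pose B : {set G} := [set x | (r <= word_length x)%N]%SET.
pose Q (q : G -> R) := exists F, q = fun x => displacement p F x - C * gradient p F.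
have [[F Fpos]|neg] := pselect (exists F : seq (G -> R), forall x, x \in B ->
    C * gradient p F < displacement p F x).
  left.
  have [grad0|grad_neq0] := eqVneq (gradient p F) 0.
    (* Without gradient nothing is displaced, so no element is long. *)
    exists [::]; split; first by rewrite gradient_nil.
    move=> x xr; have /Fpos : x \in B by rewrite inE.
    rewrite grad0 mulr0 ltNge => /negP[].
    by have := displacement_le_gradient F x p_gt0; rewrite grad0 mulr0.
  have grad_gt0 : 0 < gradient p F by rewrite lt_neqAle eq_sym grad_neq0 gradient_ge0.
  have /(displacement_scale p_gt0 F)[F' F'E] : 0 <= (gradient p F)^-1.
    by rewrite invr_ge0 ltW.
  exists F'; split; first by rewrite (gradient_scale F'E) mulVf.
  move=> x xr; rewrite F'E ler_pdivlMl// mulrC; apply/ltW/Fpos.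
  by rewrite inE.
right.
have [|||q|m [m0 m1 mB mQ]] := @cone_separation R _ B Q.
- exists [::]; apply/funext => x.
  by rewrite gradient_nil displacement_nil mulr0 subr0.
- move=> _ _ [F ->] [F' ->]; exists (F ++ F'); apply/funext => x /=.
  by rewrite displacement_cat gradient_cat; ring.
- move=> c _ c0 [F ->]; have [F' F'E] := displacement_scale p_gt0 F c0.
  by exists F'; apply/funext => x /=; rewrite F'E (gradient_scale F'E); ring.
- move=> [F ->]; apply: contra_notP neg => /forall2NP nF; exists F => x xB.
  by case: (nF x) => // /negP; rewrite subr_le0 -ltNge.
exists m; split=> // [x xr|F]; first by apply: mB; rewrite inE -ltnNge.
have /mQ : Q (fun x => displacement p F x - C * gradient p F) by exists F.
under eq_bigr do rewrite mulrBr.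
by rewrite sumrB -mulr_suml m1 mul1r subr_le0.
Qed.

(** * From dual measures to Poincare inequalities *)

Lemma sum_translate (R : realType) (p : R) (gT : finGroupType) (phi a : gT -> R) :
  \sum_g \sum_h phi (g^-1 * h)%g * `|a g - a h| `^ p =
  \sum_x phi x * displacement p [:: a] x.
Proof.
under eq_bigr => g _ do rewrite (reindex_inj (mulgI g)).
rewrite exchange_big /=; apply: eq_bigr => x _.
rewrite /displacement big_seq1 mulr_sumr; apply: eq_bigr => g _.
by rewrite mulKg.
Qed.

(** Left-invariance turns the sums over pairs into sums of displacements of a
    single function, for which the inequality is the hypothesis; functions with
    values in L^p-spaces are then reached by integration. *)
Lemma poincare_of_displacement (R : realType) (p : R) (p1 : 1 <= p)
    (G : cayley_graph) (C : R) (m : G -> R) :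
  0 <= C -> (forall x, 0 <= m x) ->
  (forall F, \sum_x m x * displacement p F x <= C * gradient p F) ->
  Lp_poincare p1 (fun g h => m (g^-1 * h)%g / #|{: G}|%:R) C.
Proof.
move=> C0 m0 ineq d T nu f.
pose N : R := #|{: G}|%:R.
have N0 : 0 <= N^-1 by rewrite invr_ge0 ler0n.
pose w' (g h : G) : R := C / N * (edge g h)%:R.
have w'0 g h : 0 <= w' g h by rewrite mulr_ge0 ?mulr_ge0.
have w0 (g h : G) : 0 <= m (g^-1 * h)%g / N by exact: mulr_ge0.
have real_ineq (a : G -> R) :
    \sum_g \sum_h m (g^-1 * h)%g / N * `|a g - a h| `^ p <=
    \sum_g \sum_h w' g h * `|a g - a h| `^ p.
  rewrite (sum_translate p (fun x => m x / N)) /w'.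
  under [leRHS]eq_bigr do under eq_bigr do rewrite edgeE.
  rewrite (sum_translate p (fun x => C / N * (edge 1%g x)%:R)).
  have := ler_wpM2r N0 (ineq [:: a]).
  rewrite mulr_suml mulrAC /gradient mulr_sumr [X in _ <= X]big_mkcond /=.
  congr (_ <= _); apply: eq_bigr => x _; first by rewrite mulrAC.
  by case: ifP; rewrite ?mulr1 ?mulr0 ?mul0r.
have := Lp_dist_transfer w0 w'0 real_ineq f.
under eq_bigr do under eq_bigr do rewrite mulrC.
move=> /le_trans; apply; rewrite mulr_sumr; apply: ler_sum => g _.
rewrite mulr_sumr [leRHS]big_mkcond /=; apply: ler_sum => h _.
by rewrite /w'; case: ifP => _; rewrite ?mulr1 ?mulr0 ?mul0r.
Qed.

Lemma poincare_measure (R : realType) (p : R) (p1 : 1 <= p)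
    (G : cayley_graph) (C : R) (r : nat) (m : G -> R) :
  0 <= C -> (forall x, 0 <= m x) -> \sum_x m x = 1 ->
  (forall x, (word_length x < r)%N -> m x = 0) ->
  (forall F, \sum_x m x * displacement p F x <= C * gradient p F) ->
  exists mu : G -> G -> R, [/\ probability_on (Delta G (r%:R : R)) mu,
    Lp_poincare p1 mu C & left_invariant mu].
Proof.
move=> C0 m0 m1 mr ineq.
have N0 : #|{: G}|%:R != 0 :> R.
  by rewrite pnatr_eq0 -lt0n; apply/card_gt0P; exists 1%g.
exists (fun g h => m (g^-1 * h)%g / #|{: G}|%:R); split.
- split=> [g h||g h].
  + by rewrite divr_ge0.
  + under eq_bigr => g _.
      rewrite (reindex_inj (mulgI g)) -mulr_suml.
      under eq_bigr do rewrite mulKg.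
      rewrite m1 div1r; over.
    by rewrite sumr_const -[LHS]mulr_natr mulVf.
  + by rewrite inE /= ler_nat -ltnNge => /mr ->; rewrite mul0r.
- exact: poincare_of_displacement.
- by move=> g g1 g2; rewrite invMg -mulgA mulKg.
Qed.

(** * Coarse embeddings into l^p *)

Lemma proper_mapP (R : realType) (h : R -> R) : (forall t, 0 <= t -> 0 <= h t) ->
  (forall M, exists t0, forall t, 0 <= t -> h t <= M -> t <= t0) <-> proper_map h.
Proof.
move=> h0; split=> [H|[_ H] M]; last first.
  have /H[M0 [_ /(_ (M0 + 1))]] : bounded_set [set t : R | 0 <= t <= M].
    exists M; split; rewrite ?num_real// => M' MM' t /= /andP[t0 tM].
    by rewrite ger0_norm// (le_trans tM)// ltW.
  rewrite ltrDl ltr01 => /(_ isT) bnd; exists (M0 + 1) => t t0 htM.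
  have /= := bnd t; rewrite ger0_norm//; apply; split=> //=.
  by rewrite h0.
split=> // A [M [_ /(_ (M + 1))]]; rewrite ltrDl ltr01 => /(_ isT) bnd.
have [t0 Ht0] := H (M + 1).
exists t0; split; rewrite ?num_real// => M' t0M' t [/= t_ge0 At].
rewrite ger0_norm// (le_trans _ (ltW t0M'))// Ht0//.
exact: (le_trans (ler_norm _) (bnd _ At)).
Qed.

(** Control functions can be built from uniform bounds alone: [rho t] is the
    infimum of the distances between the images of points at distance at least
    [t], and [b] bounds distances from above. *)
Lemma coarse_embedding_nat (R : realType) (X : nat -> Type)
    (dX : forall n, X n -> X n -> nat) (Y : Type) (dY : Y -> Y -> R)
    (phi : forall n, X n -> Y) (b : nat -> R) :
  (forall n x y, 0 <= dY (phi n x) (phi n y)) ->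
  (forall M : nat, exists r : nat, forall n x y, (r <= dX n x y)%N ->
     M%:R <= dY (phi n x) (phi n y)) ->
  (forall n x y, dY (phi n x) (phi n y) <= b (dX n x y)) ->
  coarse_embedding (fun n x y => (dX n x y)%:R) dY phi.
Proof.
move=> dY0 lower upper.
(* Adding [t] itself keeps the set nonempty, and the infimum proper, when no
   points are at distance at least [t]. *)
pose S (t : R) : set R := t |` [set s | exists n x y,
  t <= (dX n x y)%:R /\ s = dY (phi n x) (phi n y)].
have S0 t : 0 <= t -> lbound (S t) 0.
  by move=> t0 _ [->//|[n [x [y [_ ->]]]]].
exists (fun t => inf (S t)), (fun t => t + `|b (Num.truncn t)|); split.
- apply/proper_mapP => [t t0|M].
    by apply: lb_le_inf; [exists t; left|exact: S0].
  have [r Hr] := lower (Num.truncn M).+1.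
  exists (Num.max M r%:R) => t t0; apply: contraTT; rewrite -!ltNge gt_max.
  move=> /andP[Mt rt].
  have Mtr : M < (Num.truncn M).+1%:R := truncnS_gt M.
  apply: (@lt_le_trans _ _ (Num.min t (Num.truncn M).+1%:R)).
    by rewrite lt_min Mt.
  apply: lb_le_inf; first by exists t; left.
  move=> _ [->|[n [x [y [tx ->]]]]]; first by rewrite ge_min lexx.
  rewrite ge_min; apply/orP; right; apply: Hr.
  by rewrite -(ler_nat R) (le_trans (ltW rt)).
(* The summand [t] makes the upper control proper whatever [b] is. *)
- apply/proper_mapP => [t t0|M]; first by rewrite addr_ge0.
  by exists M => t t0; apply: le_trans; rewrite lerDl.
- move=> n x y; apply/andP; split.
    apply: ge_inf; first by exists 0; exact: S0.
    by right; exists n, x, y.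
  rewrite natrK (le_trans (upper n x y))// (le_trans (ler_norm _))//.
  by rewrite lerDr.
Qed.

(** The coordinates are indexed by pairs [(a, g)], and [x] is sent to
    [a (g x)]: averaging over all left translates of the family is what makes
    the distance left-invariant. *)
Lemma displacement_realization (R : realType) (p : R) (p1 : 1 <= p)
    (gT : finGroupType) (F : seq (gT -> R)) :
  exists phi : gT -> Lp_space p1 (@counting nat R), forall x y,
    Lp_dist (phi x) (phi y) `^ p = displacement p F (x^-1 * y)%g.
Proof.
pose c := [seq (a, g) | a <- F, g <- enum gT].
pose v (x : gT) k := let ag := nth (fun=> 0, 1%g) c k in ag.1 (ag.2 * x)%g : R.
have [phi phiE] := finite_vector_in_lp p1 (size c) v.
exists phi => x y; rewrite phiE /v.
rewrite -(big_nth (fun=> 0, 1%g) predT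
  (fun ag => `|ag.1 (ag.2 * x)%g - ag.1 (ag.2 * y)%g| `^ p)) /c big_allpairs_dep.
apply: eq_bigr => a _; rewrite big_enum /=.
rewrite [RHS](reindex_inj (mulIg x)); apply: eq_bigr => g _ /=.
by rewrite -mulgA mulKVg.
Qed.

Lemma Lp_dist_ge0 (R : realType) (p : R) (p1 : 1 <= p) (d : measure_display)
    (T : measurableType d) (nu : {measure set T -> \bar R})
    (f g : Lp_space p1 nu) : 0 <= Lp_dist f g.
Proof. by rewrite fine_ge0 ?Lnorm_ge0. Qed.

Lemma sum_geometric2 (R : realFieldType) n :
  \sum_(k <- iota 0 n) (2 ^+ k.+1)^-1 = 1 - (2 ^+ n)^-1 :> R.
Proof.
elim: n => [|n IH]; first by rewrite big_nil expr0 invr1 subrr.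
rewrite -addn1 iotaD big_cat IH big_seq1 add0n addn1 exprS invfM.
by rewrite /=; lra.
Qed.

(** The condition [k <= r k] allows a finite sum: the requirement for [k] is
    vacuous as soon as [k] exceeds all word lengths in [G]. *)
Lemma summed_displacement (R : realType) (p : R) (G : cayley_graph)
    (r : nat -> nat) (F : nat -> seq (G -> R)) :
  (forall k, (k <= r k)%N) ->
  (forall k, gradient p (F k) <= (2 ^+ k.+1)^-1) ->
  (forall k x, (r k <= word_length x)%N -> k%:R <= displacement p (F k) x) ->
  exists F' : seq (G -> R), gradient p F' <= 1 /\
    forall k x, (r k <= word_length x)%N -> k%:R <= displacement p F' x.
Proof.
move=> rk gradF dispF.
pose L := (\max_(x : G) word_length x).+1.
exists (flatten [seq F k | k <- iota 0 L]); split.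
  rewrite gradient_flatten; apply: (@le_trans _ _ (1 - (2 ^+ L)^-1)).
    by rewrite -sum_geometric2; apply: ler_sum.
  by rewrite gerBl invr_ge0 exprn_ge0.
move=> k x rx; apply: (le_trans (dispF k x rx)).
have kL : k \in iota 0 L.
  rewrite mem_iota add0n /= ltnS (leq_trans (rk k))// (leq_trans rx)//.
  exact: leq_bigmax.
rewrite displacement_flatten (big_rem k)//= lerDl.
by apply: sumr_ge0 => *; exact: displacement_ge0.
Qed.

(** The family number [k] has gradient [2 ^ - (k + 1)] but still displaces all
    elements of length at least [r k] by [k].  The sum of these families has
    gradient at most one, which controls distances from above, and displaces
    long elements arbitrarily far. *)
Lemma embeds_of_displacement (R : realType) (p : R) (p1 : 1 <= p)
    (G : nat -> cayley_graph) :
  (forall C : R, 0 < C -> exists r : nat, forall n, exists F : seq (G n -> R),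
     gradient p F <= 1 /\
     forall x, (r <= word_length x)%N -> C <= displacement p F x) ->
  embeds_in_some_Lp p1 G.
Proof.
move=> H; have p_gt0 : 0 < p by rewrite (lt_le_trans _ p1).
have {H} /choice[r rP] k : exists r : nat, (k <= r)%N /\
    forall n, exists F : seq (G n -> R), gradient p F <= (2 ^+ k.+1)^-1 /\
    forall x, (r <= word_length x)%N -> k%:R <= displacement p F x.
  have c_gt0 : 0 < 2 ^+ k.+1 :> R by rewrite exprn_gt0.
  (* The factor [2 ^+ k.+1] is lost when the gradient is scaled down. *)
  have [|r Hr] := H (2 ^+ k.+1 * k.+1%:R); first by rewrite mulr_gt0.
  exists (maxn k r); split=> [|n]; first exact: leq_maxl.
  have [F [gradF dispF]] := Hr n.
  have /(displacement_scale p_gt0 F)[F' F'E] : 0 <= (2 ^+ k.+1 : R)^-1.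
    by rewrite invr_ge0 ltW.
  exists F'; split.
    by rewrite (gradient_scale F'E) ler_piMr// invr_ge0 ltW.
  move=> x; rewrite geq_max => /andP[_ /dispF le_disp].
  by rewrite F'E ler_pdivlMl// (le_trans _ le_disp)// ler_pM2l// ler_nat.
have rk k : (k <= r k)%N by have [] := rP k.
pose A : R := 2 `^ p * 2.
have phiP n : exists phi : G n -> Lp_space p1 (@counting nat R), forall x y,
    Lp_dist (phi x) (phi y) `^ p <= A ^+ word_dist x y /\
    forall k, (r k <= word_dist x y)%N -> k%:R <= Lp_dist (phi x) (phi y) `^ p.
  have /choice[F FP] k := (rP k).2 n.
  have [F' [gradF' dispF']] := summed_displacement rk
    (fun k => (FP k).1) (fun k => (FP k).2).
  have [phi phiE] := displacement_realization p1 F'.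
  exists phi => x y; rewrite phiE; split; last by move=> k; exact: dispF'.
  apply: (le_trans (displacement_le_gradient F' _ p_gt0)).
  by rewrite ler_piMr// exprn_ge0// mulr_ge0 ?powR_ge0.
exists _, nat, (@counting nat R), (fun n => projT1 (cid (phiP n))).
apply: (@coarse_embedding_nat _ _ _ _ _ _ (fun n => 1 + A ^+ n)).
- by move=> n x y; exact: Lp_dist_ge0.
- move=> M; exists (r (Num.truncn (M%:R `^ p : R)).+1) => n x y.
  case: cid => phi /= /(_ x y)[_ low] /low.
  move=> /(lt_le_trans (truncnS_gt _)) lt_pow.
  rewrite leNgt; apply/negP => lt_dist.
  have : Lp_dist (phi x) (phi y) `^ p < M%:R `^ p.
    by rewrite gt0_ltr_powR ?nnegrE ?Lp_dist_ge0.
  by rewrite ltNge (ltW lt_pow).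
- move=> n x y; case: cid => phi /= /(_ x y)[up _].
  set D := Lp_dist _ _ in up *.
  (* Only [D ^ p] is bounded by [A ^+ n]; hence the extra 1 for small [D]. *)
  have [D1|D1] := leP D 1.
    by rewrite (le_trans D1)// lerDl exprn_ge0// mulr_ge0 ?powR_ge0.
  apply: (@le_trans _ _ (D `^ p)); last by rewrite (le_trans up)// lerDr.
  by rewrite -[leLHS]powRr1 ?ler_powR// ltW// (lt_trans _ D1).
Qed.

(** * Poincare inequalities and coarse embeddings *)

(** For a coarse embedding, the right-hand side of the Poincare inequality is at
    most a constant [M], the same for all the graphs, whereas the left-hand side
    is at least [M + 1] as soon as [r n] is large. *)
Lemma poincare_not_embeds (R : realType) (p : R) (p1 : 1 <= p)
    (G : nat -> cayley_graph) (D : nat) (k : nat -> nat) (r : nat -> R)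
    (mu : forall n, G (k n) -> G (k n) -> R) (C : R) :
  (forall n, #|cg_gens (G n)| <= D)%N ->
  far_poincare_sequence p1 (G := fun n => G (k n)) r mu C ->
  ~ embeds_in_some_Lp p1 G.
Proof.
move=> degG [r0 r_oo mu_on poinc] [d [T [nu [phi [rho [gamma [rho_pr gamma_pr bnd]]]]]]].
have p_gt0 : 0 < p by rewrite (lt_le_trans _ p1).
(* Edges have length 0 or 1, loops being allowed. *)
pose K := Num.max (gamma 0) (gamma 1).
pose M := `|C| * (K `^ p * (D + D)%:R).
have M0 : 0 <= M by rewrite !mulr_ge0 ?powR_ge0.
have [rho0 _] := rho_pr.
have /(proper_mapP rho0)/(_ ((M + 1) `^ p^-1))[t0 Ht0] := rho_pr.
have [n t0r] : exists n, t0 < r n.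
  move/cvgryPgt : r_oo => /(_ t0)[n _ /(_ n (leqnn n))]; by exists n.
have [mu0 mu1 mu_far] := mu_on n.
have := poinc n d T nu (phi (k n)); apply/negP; rewrite -ltNge.
pose g0 : G (k n) := 1%g.
have N_gt0 : 0 < #|{: G (k n)}|%:R :> R.
  by rewrite ltr0n; apply/card_gt0P; exists g0.
apply: (@le_lt_trans _ _ M).
  set S := (X in _ * X <= _).
  have S0 : 0 <= S by apply: sumr_ge0 => g _; apply: sumr_ge0 => h _; exact: powR_ge0.
  have S_le : S <= \sum_(g : G (k n)) K `^ p * (D + D)%:R.
    apply: ler_sum => g _.
    apply: (@le_trans _ _ (\sum_(h | edge g h) K `^ p)).
      apply: ler_sum => h /word_dist_edge gh.
      have distK : Lp_dist (phi (k n) g) (phi (k n) h) <= K.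
        have /andP[_ /le_trans] := bnd (k n) g h; apply; rewrite le_max.
        by case: word_dist gh => [|[|//]] _; rewrite lexx ?orbT.
      by rewrite ge0_ler_powR ?nnegrE ?(ltW p_gt0) ?(le_trans _ distK) ?Lp_dist_ge0.
    rewrite sumr_const -[leLHS]mulr_natr ler_wpM2l ?powR_ge0// ler_nat.
    exact/card_edge_le/degG.
  apply: (@le_trans _ _ (`|C| / #|{: G (k n)}|%:R * S)).
    by rewrite ler_wpM2r// ler_wpM2r ?ler_norm// invr_ge0 ltW.
  apply: (le_trans (ler_wpM2l _ S_le)); first by rewrite divr_ge0// ltW.
  by rewrite sumr_const -[X in _ * X]mulr_natr mulrAC -!mulrA mulfV ?gt_eqF// mulr1.
have far g h : mu n g h != 0 -> M + 1 <= Lp_dist (phi (k n) g) (phi (k n) h) `^ p.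
  move=> mu_neq0; have : (g, h) \in Delta (G (k n)) (r n).
    by apply: contra_neqT mu_neq0 => /mu_far.
  rewrite inE /= => r_dist.
  have /andP[rho_le _] := bnd (k n) g h.
  rewrite leNgt; apply/negP => lt_pow.
  have := Ht0 (word_dist g h)%:R; rewrite ler0n => /(_ isT).
  have -> : rho (word_dist g h)%:R <= (M + 1) `^ p^-1.
    apply: (le_trans rho_le).
    rewrite (_ : Lp_dist _ _ = (Lp_dist (phi (k n) g) (phi (k n) h) `^ p) `^ p^-1); last first.
      by rewrite -powRrM mulfV ?gt_eqF// powRr1// Lp_dist_ge0.
    by rewrite ge0_ler_powR ?nnegrE ?invr_ge0 ?powR_ge0 ?ltW// ltr_wpDl.
  by move=> /(_ isT); rewrite leNgt (lt_le_trans t0r).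
apply: (@lt_le_trans _ _ (M + 1)); first by rewrite ltrDl.
rewrite -[leLHS]mulr1 -[X in (M + 1) * X]mu1 mulr_sumr; apply: ler_sum => g _.
rewrite mulr_sumr; apply: ler_sum => h _.
have [->|/far] := eqVneq (mu n g h) 0; first by rewrite !mulr0.
exact: ler_wpM2r.
Qed.

(** A probability supported on elements of length at least [r] forces the
    diameter of the graph to be at least [r]; taking [r] above the diameters of
    the first [N] graphs gives an index beyond them, from which a subsequence
    is extracted recursively. *)
Lemma exists_poincare_subsequence (R : realType) (p : R) (p1 : 1 <= p)
    (G : nat -> cayley_graph) (C : R) : 0 <= C ->
  (forall r : nat, exists n, exists m : G n -> R,
     [/\ forall x, 0 <= m x, \sum_x m x = 1,
       forall x, (word_length x < r)%N -> m x = 0 &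
       forall F, \sum_x m x * displacement p F x <= C * gradient p F]) ->
  exists (k : nat -> nat) (r : nat -> R) (mu : forall n, G (k n) -> G (k n) -> R),
    [/\ {homo k : m n / (m < n)%N},
      far_poincare_sequence p1 (G := fun n => G (k n)) r mu C &
      forall n, left_invariant (mu n)].
Proof.
move=> C0 H.
pose P (r n : nat) := exists mu : G n -> G n -> R,
  [/\ probability_on (Delta (G n) (r%:R : R)) mu, Lp_poincare p1 mu C & left_invariant mu].
have far_index r N : exists n, (N <= n)%N /\ P r n.
  pose diam n := (\max_(x : G n) word_length x)%N.
  have [n [m [m0 m1 mr ineq]]] := H (maxn r (\max_(i < N) diam i).+1).
  exists n; split; last first.
    apply: (poincare_measure p1 C0 m0 m1 _ ineq) => x xr; apply: mr.
    by rewrite leq_max xr.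
  rewrite leqNgt; apply/negP => nN.
  have : \sum_x m x = 0; last by rewrite m1 => /eqP; rewrite oner_eq0.
  apply: big1 => x _; apply: mr; rewrite leq_max ltnS; apply/orP; right.
  apply: (@leq_trans (diam n)); first exact: (@leq_bigmax _ (fun y : G n => word_length y) x).
  exact: (@leq_bigmax _ (fun i : 'I_N => diam i) (Ordinal nN)).
have {far_index} /choice[f fP] (u : nat * nat) : exists n, (u.2 <= n)%N /\ P u.1 n.
  exact: far_index.
pose k := fix k n := if n is n'.+1 then f (n, (k n').+1) else f (0, 0)%N.
have kP n : P n (k n) by case: n => [|n]; [exact: (fP (0, 0)%N).2|exact: (fP (n.+1, (k n).+1)).2].
exists k, (fun n => n%:R), (fun n => projT1 (cid (kP n))); split.
- by apply: (homo_ltn ltn_trans) => n; exact: (fP (n.+1, (k n).+1)).1.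
- split.
  + by move=> n; exact: ler0n.
  + exact: cvgr_idn.
  + by move=> n; case: cid => mu [].
  + by move=> n; case: cid => mu [].
- by move=> n; case: cid => mu [].
Qed.

Theorem theorem1p3 (R : realType) (p : R) (p1 : 1 <= p)
    (G : nat -> cayley_graph)
    (degG : exists D : nat, forall n, (#|cg_gens (G n)| <= D)%N) :
  (~ embeds_in_some_Lp p1 G <->
     exists (k : nat -> nat) (r : nat -> R)
       (mu : forall n, G (k n) -> G (k n) -> R) (C : R),
       {homo k : m n / (m < n)%N} /\
       far_poincare_sequence p1 (G := fun n => G (k n)) r mu C)
  /\
  (~ embeds_in_some_Lp p1 G <->
     exists (k : nat -> nat) (r : nat -> R)
       (mu : forall n, G (k n) -> G (k n) -> R) (C : R),
       [/\ {homo k : m n / (m < n)%N},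
           far_poincare_sequence p1 (G := fun n => G (k n)) r mu C &
           forall n, left_invariant (mu n)]).
Proof.
have [D degD] := degG.
have p_gt0 : 0 < p by rewrite (lt_le_trans _ p1).
have poincare : ~ embeds_in_some_Lp p1 G -> exists (k : nat -> nat) (r : nat -> R)
    (mu : forall n, G (k n) -> G (k n) -> R) (C : R),
    [/\ {homo k : m n / (m < n)%N},
      far_poincare_sequence p1 (G := fun n => G (k n)) r mu C &
      forall n, left_invariant (mu n)].
  move=> not_emb; apply: contrapT => no_poincare; apply: not_emb.
  apply: embeds_of_displacement => C C0; apply: contrapT => no_disp.
  apply: no_poincare.
  have [|k [r [mu kP]]] := @exists_poincare_subsequence R p p1 G C (ltW C0); last by exists k, r, mu, C.
  move=> r; apply: contrapT => no_measure; apply: no_disp; exists r => n.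
  have [//|[m mP]] := @displacement_dichotomy R p (G n) C r p_gt0.
  by case: no_measure; exists n, m.
split; split.
- by move=> /poincare[k [r [mu [C [? ? _]]]]]; exists k, r, mu, C.
- by move=> [k [r [mu [C [_ far]]]]]; exact: poincare_not_embeds degD far.
- exact: poincare.
- by move=> [k [r [mu [C [_ far _]]]]]; exact: poincare_not_embeds degD far.
Qed.
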